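(* Let $\mathcal B^2$ be a $2$-dimensional manifold with an affine structure with focus points, and let $O\in\mathcal B^2$ be a focus point of index $k>0$ with a local multi-valued affine coordinate system $(F,G)$ (with branches $G_l,G_r$ of $G$) such that $F(O)=G(O)=0$. Then every $2$-dimensional focus box $$Box(\delta,\delta')=\{x : F(x)\in[-\delta,\delta],\ G_l(x)\in[-\delta',\delta'],\ G_r(x)\in[-\delta',\delta']\}$$ around $O$ (with $\delta,\delta'>0$ small enough that this set is well defined in the domain of the coordinate system) is convex.
   Context: Affine structure with focus points (dimension 2, interior point). A singular affine surface $\mathcal B^2$ is a smooth surface with a sheaf of smooth functions (local affine functions, stable under real linear combinations and containing the constants) such that near each point of an open dense set (the regular points) two affine functions with independent differentials form local coordinates and, together with constants, span the affine functions. Every non-regular point $O$ is isolated and is a focus point: in a neighborhood $V$ of $O$ there are a single-valued affine function $F$, a smooth function $H$ such that $(F,H)$ are smooth coordinates with $O=\{F=H=0\}$, and two continuous functions $G_l,G_r$ on $V$ (branches of a multi-valued function $G$) such that: $G_l$ is affine on $V\setminus\{F=0,H\ge 0\}$; $G_r$ is affine on $V\setminus\{F=0,H\le 0\}$; $G_l=G_r=:G$ when $F\le 0$; $G_r=G_l+kF$ when $F\ge 0$, where $k>0$ is a constant called the index of $O$; and $\partial G_l/\partial H=\partial G_r/\partial H>0$ away from $O$. On the regular part $(F,G_l)$ or $(F,G_r)$ (where affine) are affine coordinates. The triple $(F,G_l,G_r)$ is called a multi-valued affine coordinate system around $O$. The index $k$ need not be an integer. Straight lines. A curve is a continuous map from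 an interval to $\mathcal B^2$. A regular straight line is a curve in the regular part that is affine in every local affine chart. A singular straight line is a non-constant parametrized continuous curve $\gamma:I\to\mathcal B^2$ containing focus points such that every $t_0$ in the interior of $I$ has a neighborhood $[s,t]\subset I$ on which $\gamma$ is a (uniform) limit of affinely parametrized regular straight lines $\gamma_n:[s,t]\to\mathcal B^2$. A straight line is a regular or a singular straight line. Convexity. A subset $C$ is convex if any two points of $C$ can be joined by at least one (regular or singular) straight line contained in $C$. *)

(* Defs.v *)
From HB Require Import structures.
From mathcomp Require Import all_boot all_order all_algebra.
From mathcomp Require Import all_classical all_reals all_analysis.

Set Implicit Arguments.
Unset Strict Implicit.
Unset Printing Implicit Defensive.

Import Order.TTheory GRing.Theory Num.Theory.
Import numFieldNormedType.Exports.

Local Open Scope classical_set_scope.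
Local Open Scope ring_scope.

(* Here and below, functions attached to an open set (functions on it, charts,
   inverses of charts) are total functions whose values off that set are
   irrelevant. *)

Section SmoothPlane.
Variable R : realType.

Fixpoint Ck (n : nat) (W : set (R * R)) (f : R * R -> R) : Prop :=
  {in W, continuous f} /\
  if n is m.+1 then
    [/\ forall p, W p -> derivable f p (1, 0) /\ derivable f p (0, 1),
        Ck m W (fun p => 'D_(1, 0) f p) &
        Ck m W (fun p => 'D_(0, 1) f p)]
  else True.

Definition smooth (W : set (R * R)) (f : R * R -> R) := forall n, Ck n W f.

End SmoothPlane.

Section SmoothSurface.
Variables (R : realType) (T : topologicalType).

Record chart := Chart {
  cdom : set T ;
  cmap : T -> R * R ;
  cinv : R * R -> T }.

Definition is_chart (c : chart) :=
  [/\ open (cdom c),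
      open (cmap c @` cdom c),
      forall x, cdom c x -> cinv c (cmap c x) = x,
      {in cdom c, continuous (cmap c)} &
      {in cmap c @` cdom c, continuous (cinv c)}].

Definition smooth_transition (c d : chart) :=
  let W := cmap c @` (cdom c `&` cdom d) in
  smooth W (fun p => (cmap d (cinv c p)).1) /\
  smooth W (fun p => (cmap d (cinv c p)).2).

Definition smooth_atlas (atlas : set chart) :=
  [/\ forall c, atlas c -> is_chart c,
      forall x, exists2 c, atlas c & cdom c x &
      forall c d, atlas c -> atlas d -> smooth_transition c d].

(* Charts of the maximal atlas. *)
Definition smooth_chart (atlas : set chart) (c : chart) :=
  is_chart c /\
  forall d, atlas d -> smooth_transition c d /\ smooth_transition d c.

Definition smooth_on (atlas : set chart) (W : set T) (f : T -> R) :=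
  forall c, atlas c -> smooth (cmap c @` (cdom c `&` W)) (f \o cinv c).

Definition smooth_coordinates (atlas : set chart) (U : set T) (f g : T -> R) :=
  exists c, [/\ smooth_chart atlas c, cdom c = U &
    forall x, U x -> cmap c x = (f x, g x)].

End SmoothSurface.

Section AffineStructure.
Variables (R : realType) (T : topologicalType).
Variable atlas : set (chart R T).
(* [A U f]: the restriction of [f] to the open set [U] is an affine function *)
Variable A : set T -> set (T -> R).

(* Since functions are total, a compatible family of sections is induced by one
   total function, so that [af_glue] and [af_ext] give the gluing axiom. *)
Record affine_sheaf : Prop := AffineSheaf {
  af_smooth : forall U f, open U -> A U f -> smooth_on atlas U f ;
  af_ext : forall U f g, open U -> {in U, f =1 g} -> A U f -> A U g ;
  af_restrict : forall U V f, open U -> open V -> V `<=` U -> A U f -> A V f ;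
  af_glue : forall U f, open U ->
    (forall x, U x -> exists V, [/\ open V, V x, V `<=` U & A V f]) -> A U f ;
  af_cst : forall U (a : R), open U -> A U (cst a) ;
  af_lin : forall U (a b : R) f g, open U -> A U f -> A U g ->
    A U (fun x => a * f x + b * g x) }.

(* Local affine coordinates. The differentials of [f] and [g] are independent
   on [U] because (f, g) is a smooth chart there. *)
Definition affine_chart (U : set T) (f g : T -> R) :=
  [/\ smooth_coordinates atlas U f g, A U f, A U g &
      forall W h x, open W -> W `<=` U -> A W h -> W x ->
        exists a b e : R, \forall y \near x, h y = a * f y + b * g y + e].

Definition regular (x : T) := exists U f g, U x /\ affine_chart U f g.

(* [c] is the chart given by the smooth coordinates (F, H), with domain V. *)
Definition focus_coordinates (O : T) (k : R) (c : chart R T)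
    (Gl Gr : T -> R) : Prop :=
  let V := cdom c in
  let F x := (cmap c x).1 in
  let H x := (cmap c x).2 in
  (V O /\ smooth_chart atlas c) /\
  (forall x, V x -> (x = O <-> F x = 0 /\ H x = 0)) /\
  A V F /\
  ({in V, continuous Gl} /\ {in V, continuous Gr}) /\
  affine_chart (V `\` [set x | F x = 0 /\ 0 <= H x]) F Gl /\
  affine_chart (V `\` [set x | F x = 0 /\ H x <= 0]) F Gr /\
  0 < k /\
  (forall x, V x -> F x <= 0 -> Gl x = Gr x) /\
  (forall x, V x -> 0 <= F x -> Gr x = Gl x + k * F x) /\
  (* the partial derivatives with respect to H exist, agree, are positive *)
  (forall x, V x -> x <> O -> exists2 d : R, 0 < d &
    is_derive (cmap c x) (0, 1) (Gl \o cinv c) d /\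
    is_derive (cmap c x) (0, 1) (Gr \o cinv c) d).

Definition focus_point (O : T) :=
  exists k c Gl Gr, focus_coordinates O k c Gl Gr.

End AffineStructure.

Record focus_affine_surface (R : realType) := FocusAffineSurface {
  surface :> topologicalType ;
  surface_hausdorff : hausdorff_space surface ;
  surface_countable : @second_countable surface ;
  atlas : set (chart R surface) ;
  surface_atlas : smooth_atlas atlas ;
  affine : set surface -> set (surface -> R) ;
  surface_affine : affine_sheaf atlas affine ;
  regular_open : open (regular atlas affine) ;
  regular_dense : dense (regular atlas affine) ;
  nonregular_isolated : forall x : surface,
    ~ regular atlas affine x -> isolated (~` regular atlas affine) x ;
  nonregular_focus : forall x : surface,
    ~ regular atlas affine x -> focus_point atlas affine x }.

Section StraightLines.
Variables (R : realType) (B : focus_affine_surface R).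

Definition regular_straight_line (I : set R) (g : R -> B) :=
  [/\ is_interval I, {within I, continuous g},
      forall t, I t -> regular (@atlas R B) (@affine R B) (g t) &
      forall U f1 f2 (J : set R), affine_chart (@atlas R B) (@affine R B) U f1 f2 ->
        is_interval J -> J `<=` I -> g @` J `<=` U ->
        (exists a b : R, forall t, J t -> f1 (g t) = a * t + b) /\
        (exists a b : R, forall t, J t -> f2 (g t) = a * t + b)].

(* Convergence in the compact-open topology of maps [s, t] -> B: as [s, t] is
   compact and [g] continuous on it, this is uniform convergence for any metric
   compatible with the topology of B. *)
Definition uniform_limit (s t : R) (gn : nat -> R -> B) (g : R -> B) :=
  forall (K : set R) (U : set B), compact K -> K `<=` `[s, t] ->
    open U -> g @` K `<=` U -> \forall n \near \oo, gn n @` K `<=` U.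

Definition singular_straight_line (I : set R) (g : R -> B) :=
  [/\ is_interval I, {within I, continuous g},
      exists a b, [/\ I a, I b & g a <> g b],
      exists2 t, I t & focus_point (@atlas R B) (@affine R B) (g t) &
      forall t0, interior I t0 -> exists s t : R,
        [/\ s < t0 < t, `[s, t] `<=` I &
            exists2 gn : nat -> R -> B,
              forall n, regular_straight_line `[s, t] (gn n) &
              uniform_limit s t gn g]].

Definition straight_line (I : set R) (g : R -> B) :=
  regular_straight_line I g \/ singular_straight_line I g.

Definition convex_subset (C : set B) :=
  forall x y, C x -> C y ->
    exists (I : set R) (g : R -> B),
      [/\ straight_line I g, g @` I `<=` C,
          exists2 s, I s & g s = x & exists2 t, I t & g t = y].

(* "Small enough to be well defined in the domain of the coordinates" is
   expressed by compactness of this set: it is then cut out by the three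
   inequalities alone, and does not run into the frontier of [cdom c]. *)
Definition focus_box (c : chart R B) (Gl Gr : B -> R) (delta delta' : R) : set B :=
  [set x | [/\ cdom c x,
    - delta <= (cmap c x).1 <= delta,
    - delta' <= Gl x <= delta' &
    - delta' <= Gr x <= delta']].

End StraightLines.

(* Main.v *)
Require Import Defs.
From HB Require Import structures.
From mathcomp Require Import all_boot all_order all_algebra.
From mathcomp Require Import all_classical all_reals all_analysis.
From mathcomp Require Import ring lra.
Import Order.TTheory GRing.Theory Num.Theory.
Import numFieldNormedType.Exports.
Local Open Scope classical_set_scope.
Local Open Scope ring_scope.

(** Since Gr = Gl + k max(F, 0), the map (F, Gl) sends the box into an explicit
    convex polygon Q.  Off the line F = 0 it is an open embedding, so a connectedness
    argument along segments and compactness of the box show that it is onto Q.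
    Two points of the box over F = 0 with the same value of G are both limits
    of points with F < 0 and that value of G, so it is injective, hence
    a homeomorphism onto Q.

    If two points lie on the same side of F = 0, the segment between them in
    Q is a straight line; when it contains O it is a limit of segments shifted
    off the line F = 0.  If F(x) < 0 < F(y), the segment in the coordinates
    (F, Gl) meets F = 0 at a smaller height than the one in (F, Gr); so either the
    former is below O, where (F, Gl) is affine, or the latter is above O, where
    (F, Gr) is affine. *)

(** * Lifting paths and limits through a continuous injection of a compact set *)

Section CompactInjection.
Variables (T U : topologicalType) (K : set T) (f : T -> U).
Hypotheses (hU : hausdorff_space U) (cK : compact K).
Hypotheses (fcont : {within K, continuous f}) (finj : set_inj K f).

(** The part of [K] outside the interior of [N] is compact, so its image is closed in the Hausdorff
    space [U]. By injectivity this image misses [f x], and its complement is the required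
    neighborhood. This is continuity of the inverse of [f], stated without naming an inverse. *)
Lemma compact_inj_near (x : T) (N : set T) : K x -> nbhs x N ->
  \forall y \near f x, forall z, K z -> f z = y -> N z.
Proof.
move=> Kx Nx.
have cD : compact (f @` (K `&` ~` N°)).
  apply: continuous_compact.
    by apply: continuous_subspaceW fcont => z [].
  by apply: compact_closedI => //; apply: open_closedC; exact: open_interior.
have /closed_openC oD := compact_closed hU cD.
have nDx : (~` (f @` (K `&` ~` N°))) (f x).
  move=> [z [Kz Nz] fzx]; apply: Nz.
  by rewrite (finj z x) ?inE.
have : nbhs (f x) (~` (f @` (K `&` ~` N°))) by exact: open_nbhs_nbhs.
apply: filterS => y Dy z Kz fzy; apply: contrapT => Nz; apply: Dy.
by exists z => //; split => // /interior_subset.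
Qed.

Lemma compact_inj_path_continuous (S : topologicalType) (I : set S)
    (g : S -> T) (p : S -> U) :
  (forall t, I t -> K (g t)) -> (forall t, I t -> f (g t) = p t) ->
  {in I, continuous p} -> {within I, continuous g}.
Proof.
move=> gK fg pcont; apply/subspace_continuousP => t It N Nt.
have := compact_inj_near (g t) N (gK t It) Nt.
rewrite fg// => /(pcont t (mem_set It)) pN.
change (\forall s \near t, I s -> N (g s)).
have {}pN : \forall s \near t, forall z, K z -> f z = p s -> N z by exact: pN.
by apply: filterS pN => s H Is; apply: (H (g s)); [exact: gK|exact: fg].
Qed.

End CompactInjection.

(** Convergence of the images, jointly in the parameter and the index, is pulled back by continuity
    of the inverse. Compactness of the parameter set, in its near-covering form, then turns a
    threshold near each parameter into a common one. *)
Lemma compact_inj_uniform_limit (R : realType) (B : focus_affine_surface R)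
    (U : topologicalType) (K : set B) (f : B -> U) (s t : R)
    (gn : nat -> R -> B) (g : R -> B) (pn : nat -> R -> U) (p : R -> U) :
  hausdorff_space U -> compact K -> {within K, continuous f} -> set_inj K f ->
  (forall u, s <= u <= t -> K (g u) /\ f (g u) = p u) ->
  (forall n u, s <= u <= t -> K (gn n u) /\ f (gn n u) = pn n u) ->
  (forall u, s <= u <= t -> pn q.2 q.1 @[q --> (u, \oo)] --> p u) ->
  uniform_limit s t gn g.
Proof.
move=> hU cK fc fi gp gnp lim C W cC Cst oW gW.
suff : \forall n \near \oo, C `<=` [set u | s <= u <= t -> W (gn n u)].
  apply: filterS => n CW _ [u Cu <-]; apply: CW => //.
  by have := Cst _ Cu; rewrite /= in_itv.
move/compact_near_coveringP : cC => /(_ nat \oo (fun n u => s <= u <= t -> W (gn n u))).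
apply => u Cu.
have ust : s <= u <= t by have := Cst _ Cu; rewrite /= in_itv.
have [Kgu fgu] := gp _ ust.
have Wgu : nbhs (g u) W by apply: open_nbhs_nbhs; split => //; apply: gW; exists u.
have := compact_inj_near _ _ _ _ hU cK fc fi (g u) W Kgu Wgu.
rewrite fgu => /(lim _ ust) lim_u.
have {}lim_u : \forall q \near (u, \oo), forall z, K z -> f z = pn q.2 q.1 -> W z.
  exact: lim_u.
apply: filterS lim_u => -[v n] /= H vst.
by have [Kv fv] := gnp n v vst; exact: H.
Qed.

(** * Functions affine along an interval, and a local criterion for straight lines *)

Section AffineAlong.
Variable R : realType.
Implicit Types (J : set R) (h : R -> R).

Definition affine_along J h := exists a b : R, forall t, J t -> h t = a * t + b.

Lemma interval_limit_point J (v u : R) (M : set R) :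
  is_interval J -> J u -> J v -> v != u -> nbhs u M ->
  exists s, [/\ J s, M s & s != u].
Proof.
move=> iJ Ju Jv vu Mu.
have : u + e * (v - u) @[e --> 0] --> u + 0 * (v - u).
  by apply: cvgD; [exact: cvg_cst|apply: cvgM; [exact: cvg_id|exact: cvg_cst]].
rewrite mul0r addr0 => /(_ _ Mu) /= /nbhs_ballP[r /= r0 rM].
(* The bound [1/2] keeps the point between [u] and [v]; the bound [r / 2] keeps it in [M]. *)
pose e := Num.min 2^-1 (r / 2).
have e0 : 0 < e by rewrite lt_min invr_gt0 ltr0n divr_gt0.
have er : e < r by rewrite gt_min; apply/orP; right; lra.
have e1 : e <= 1 by rewrite ge_min; apply/orP; left; lra.
exists (u + e * (v - u)); split.
- case: (ltgtP u v) vu => // uv _.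
  + by apply: (iJ u v) => //; nra.
  + by apply: (iJ v u) => //; nra.
- by apply: (rM e); rewrite /ball /= sub0r normrN gtr0_norm.
- by rewrite -subr_eq0 addrAC subrr add0r mulf_neq0 ?(lt0r_neq0 e0) ?subr_eq0.
Qed.

(** Affine functions that agree at two distinct points have equal coefficients. Hence the points of
    [J] near which [h] has the coefficients found at [u] form a subset that is both open and closed,
    and [J] is connected. An interval with at most one point is treated apart, since it does not
    determine coefficients. *)
Lemma locally_affine_along J h : is_interval J ->
  (forall t, J t -> exists a b, \forall s \near t, J s -> h s = a * s + b) ->
  affine_along J h.
Proof.
move=> iJ loc.
have [[u [v [Ju Jv vu]]]|one] := pselect (exists u v, [/\ J u, J v & v != u]); last first.
  have [[u Ju]|J0] := pselect (exists u, J u).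
    exists 0, (h u) => t Jt; rewrite mul0r add0r; congr h.
    by apply: contrapT => /eqP tu; apply: one; exists u, t.
  by exists 0, 0 => t Jt; exfalso; apply: J0; exists t.
have lim w M : J w -> nbhs w M -> exists s, [/\ J s, M s & s != w].
  have [->|wu] := eqVneq w u => Jw Mw.
    exact: (interval_limit_point J v).
  by apply: (interval_limit_point J u) => //; rewrite eq_sym.
have [a [b hab]] := loc u Ju.
pose C : set R := [set s | J s -> h s = a * s + b]°.
have : J `&` C = J.
  have /connected_intervalP := iJ; apply.
  - by exists u.
  - by exists C => //; exact: open_interior.
  - exists (closure (J `&` C)); first exact: closed_closure.
    apply/seteqP; split => [t [Jt Ct]|t [Jt Ct]].
      by split => //; apply: subset_closure.
    split => //.
    have [a' [b' hab']] := loc t Jt.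
    have [w [[Jw Cw] Nw]] := Ct _ (nbhs_interior hab').
    have [s [Js [Ms Ms'] sw]] := lim w _ Jw (filterI Cw Nw).
    have := nbhs_singleton Cw Jw; have := nbhs_singleton Nw Jw.
    have := Ms Js; have := Ms' Js => -> e1 -> e2.
    have aa : a' = a.
      apply: (@mulIf _ (s - w)); first by rewrite subr_eq0.
      lra.
    have bb : b' = b by subst a'; lra.
    by rewrite aa bb in hab'.
move=> JC; exists a, b => t Jt.
have : (J `&` C) t by rewrite JC.
by move=> [_ /interior_subset]; apply.
Qed.

End AffineAlong.

(** The definition tests every affine chart on every subinterval; one chart around each point is
    enough. On the overlap of two charts a coordinate of one is locally a linear combination of
    those of the other plus a constant, so it is locally affine along [g], hence affine along the
    subinterval. *)
Lemma regular_straight_line_local (R : realType) (B : focus_affine_surface R)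
    (I : set R) (g : R -> B) :
  is_interval I -> {within I, continuous g} ->
  (forall t, I t -> exists U f1 f2,
    [/\ U (g t), affine_chart (@atlas R B) (@affine R B) U f1 f2,
        affine_along _ I (f1 \o g) & affine_along _ I (f2 \o g)]) ->
  regular_straight_line I g.
Proof.
move=> iI gc loc; split => //.
  by move=> t /loc[U [f1 [f2 [? ? _ _]]]]; exists U, f1, f2.
move=> U f1 f2 J Uf iJ JI gJU.
have sh := @surface_affine R B.
have oU V h1 h2 : affine_chart (@atlas R B) (@affine R B) V h1 h2 -> open V.
  by move=> [[c [[[oc _ _ _ _] _] <- _]] _ _ _].
suff aff h : @affine R B U h -> affine_along _ J (h \o g).
  by case: Uf => _ /aff ? /aff ? _.
move=> Uh; apply: locally_affine_along => // t Jt.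
have [V [h1 [h2 [Vt Vch [a1 [b1 e1]] [a2 [b2 e2]]]]]] := loc t (JI _ Jt).
have oUV : open (U `&` V) by apply: openI; [exact: oU Uf|exact: oU Vch].
have hUV : @affine R B (U `&` V) h.
  by apply: (af_restrict sh) Uh => //; exact: oU Uf.
case: Vch => _ _ _ /(_ (U `&` V) h (g t) oUV (@subIsetr _ _ _) hUV).
case; first by split => //; apply: gJU; exists t.
move=> a [b [e hE]].
exists (a * a1 + b * a2), (a * b1 + b * b2 + e).
have /subspace_continuousP/(_ t (JI _ Jt) _ hE) {}hE := gc.
have {}hE : \forall s \near t, I s -> h (g s) = a * h1 (g s) + b * h2 (g s) + e.
  exact: hE.
apply: filterS hE => s hs Js.
rewrite /= hs; last exact: JI.
have := e1 s (JI _ Js); have := e2 s (JI _ Js); rewrite /= => -> ->.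
by ring.
Qed.


(** * Signs of convex combinations *)

Lemma convex_ge0 (R : realType) (a b t : R) :
  0 <= a -> 0 <= b -> 0 <= t <= 1 -> 0 <= a + t * (b - a).
Proof.
move=> a0 b0 /andP[t0 t1].
have -> : a + t * (b - a) = (1 - t) * a + t * b by ring.
by apply: addr_ge0; apply: mulr_ge0; lra.
Qed.

Lemma convex_gt0 (R : realType) (a b t : R) :
  0 <= a -> 0 < b -> 0 <= t <= 1 -> 0 < a \/ 0 < t -> 0 < a + t * (b - a).
Proof.
move=> a0 b0 /andP[t0 t1] at0.
have -> : a + t * (b - a) = (1 - t) * a + t * b by ring.
have [t'0|tn0] := ltP 0 t.
  by apply: ltr_wpDl; [apply: mulr_ge0; lra|exact: mulr_gt0].
have -> : t = 0 by apply/eqP; rewrite eq_le t0 tn0.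
by case: at0 => ?; lra.
Qed.

(** * Smooth coordinates as injective open maps *)

Section SmoothCoordinates.
Variables (R : realType) (T : topologicalType) (atl : set (chart R T)).
Variables (U : set T) (f g : T -> R).
Hypothesis Ufg : smooth_coordinates atl U f g.

Lemma smooth_coordinates_inj (x y : T) :
  U x -> U y -> f x = f y -> g x = g y -> x = y.
Proof.
case: Ufg => c [[[_ _ inv _ _] _] cU cm] Ux Uy fxy gxy.
rewrite -(inv x) ?cU// -(inv y) ?cU//.
by rewrite (cm x Ux) (cm y Uy) fxy gxy.
Qed.

Lemma smooth_coordinates_near (x : T) (N : set T) : U x -> nbhs x N ->
  \forall q \near (f x, g x), exists y, [/\ U y, N y, f y = q.1 & g y = q.2].
Proof.
case: Ufg => c [[[oc oi inv cc ci] _] cU cm] Ux Nx.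
rewrite -(cm x Ux).
have imx : (cmap c @` cdom c) (cmap c x) by exists x => //; rewrite cU.
have Ox : \forall q \near cmap c x, (cmap c @` cdom c) q by exact: open_nbhs_nbhs.
have := ci _ (mem_set imx) N; rewrite inv ?cU// => /(_ Nx) Ninv.
have {}Ninv : \forall q \near cmap c x, N (cinv c q) by exact: Ninv.
apply: filterS2 Ox Ninv => _ [z cz <-]; rewrite inv// => Nz.
by rewrite cU in cz; exists z; rewrite (cm z cz).
Qed.

End SmoothCoordinates.
Arguments smooth_coordinates_inj {R T atl U f g}.
Arguments smooth_coordinates_near {R T atl U f g}.

(** * The focus box, its coordinates and the polygon [Q] *)

Section FocusBox.
Variables (R : realType) (B : focus_affine_surface R) (O : B) (k : R).
Variables (c : chart R B) (Gl Gr : B -> R) (delta delta' : R).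
Hypothesis foc : focus_coordinates (@atlas R B) (@affine R B) O k c Gl Gr.
Hypotheses (GlO : Gl O = 0) (d0 : 0 < delta) (d'0 : 0 < delta').

Let V := cdom c.
Let F x := (cmap c x).1.
Let H x := (cmap c x).2.
Let K := focus_box c Gl Gr delta delta'.
Hypothesis cK : compact K.

Let Ul := V `\` [set x | F x = 0 /\ 0 <= H x].
Let Ur := V `\` [set x | F x = 0 /\ H x <= 0].

Let VO : V O. Proof. by case: foc => -[]. Qed.

Let Oeq x : V x -> x = O <-> F x = 0 /\ H x = 0.
Proof. by case: foc => _ [E _] /E. Qed.

Let Vchart : is_chart c. Proof. by case: foc => -[_ []]. Qed.

Let FO : F O = 0. Proof. by have [/(_ erefl)[]] := Oeq O VO. Qed.
Let HO : H O = 0. Proof. by have [/(_ erefl)[]] := Oeq O VO. Qed.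

Let Gl_cont : {in V, continuous Gl}.
Proof. by case: foc => _ [_ [_ [[]]]]. Qed.

Let Gr_cont : {in V, continuous Gr}.
Proof. by case: foc => _ [_ [_ [[]]]]. Qed.

Let Ul_chart : affine_chart (@atlas R B) (@affine R B) Ul F Gl.
Proof. by case: foc => _ [_ [_ [_ []]]]. Qed.

Let Ur_chart : affine_chart (@atlas R B) (@affine R B) Ur F Gr.
Proof. by case: foc => _ [_ [_ [_ [_ []]]]]. Qed.

Let k0 : 0 < k. Proof. by case: foc => _ [_ [_ [_ [_ [_ []]]]]]. Qed.

Let GrE x : V x -> Gr x = Gl x + k * Num.max (F x) 0.
Proof.
case: foc => _ [_ [_ [_ [_ [_ [_ [Gneg [Gpos _]]]]]]]] Vx.
have [F0|F0] := leP (F x) 0; first by rewrite mulr0 addr0 Gneg.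
by rewrite Gpos// ltW.
Qed.

Let dG x : V x -> x <> O -> exists2 d : R, 0 < d &
  is_derive (cmap c x) (0, 1) (Gl \o cinv c) d.
Proof.
case: foc => _ [_ [_ [_ [_ [_ [_ [_ [_ D]]]]]]]] Vx xO.
by have [d d0' [? _]] := D x Vx xO; exists d.
Qed.

Let Ul_sc : smooth_coordinates (@atlas R B) Ul F Gl. Proof. by case: Ul_chart. Qed.
Let Ur_sc : smooth_coordinates (@atlas R B) Ur F Gr. Proof. by case: Ur_chart. Qed.

Let Ul_F x : V x -> F x != 0 -> Ul x.
Proof. by move=> Vx /eqP F0; split => // -[]. Qed.

(** The half-lines removed from [V] in [Ul] and [Ur] meet only at [O]. *)
Let Ulr x : V x -> x <> O -> Ul x \/ Ur x.
Proof.
move=> Vx xO; have [xl|xl] := pselect (F x = 0 /\ 0 <= H x); last by left.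
right; split => // -[_ Hx]; apply: xO; apply/Oeq => //; split; first by case: xl.
by apply/eqP; rewrite eq_le Hx; case: xl.
Qed.

Let Phi x := (F x, Gl x).

(* The image of the box under Phi: as Gl <= Gr, only Gl is bounded from below and
   only Gr from above. *)
Let Q : set (R * R) := [set q | [/\ - delta <= q.1 <= delta,
  - delta' <= q.2 & q.2 + k * Num.max q.1 0 <= delta']].

Let KE x : K x <-> V x /\ Q (Phi x).
Proof.
split=> [[Vx Fx Glx Grx]|[Vx [/= Fx G1 G2]]].
  by split => //; rewrite GrE// in Grx; split => //=; lra.
have m0 : 0 <= k * Num.max (F x) 0.
  by apply: mulr_ge0; rewrite ?le_max ?lexx ?orbT// ltW.
by split; rewrite ?GrE//; lra.
Qed.

Let Phi_cont x : V x -> {for x, continuous Phi}.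
Proof.
move=> Vx; have [_ _ _ cc _] := Vchart.
have {}cc : cmap c @ x --> cmap c x by exact: cc (mem_set Vx).
have Fx : F @ x --> F x by exact: (cvg_comp _ _ cc (@cvg_fst _ _ (nbhs (F x)) (nbhs (cmap c x).2) _)).
have Gx : Gl @ x --> Gl x by exact: Gl_cont (mem_set Vx).
exact: (@cvg_pair _ _ _ _ (nbhs (F x)) (nbhs (Gl x)) _ _ _ F Gl Fx Gx).
Qed.

Let PhiK : {within K, continuous Phi}.
Proof.
by apply: continuous_in_subspaceT => x /set_mem/KE[Vx _]; exact: Phi_cont.
Qed.

(** * Behavior near [O] in the smooth coordinates [(F, H)] *)

Let pt (a b : R) := cinv c (a, b).

Let cvg_pt (N : set B) : nbhs O N ->
  exists2 r : R, 0 < r & forall a b, `|a| < r -> `|b| < r ->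
    [/\ V (pt a b), F (pt a b) = a, H (pt a b) = b & N (pt a b)].
Proof.
move=> NO; have [_ oW inv _ ci] := Vchart.
have cO : cmap c O = (0, 0).
  by rewrite (surjective_pairing (cmap c O)) -/(F O) -/(H O) FO HO.
have WO : (cmap c @` V) (0, 0) by exists O.
have W0 : nbhs (0, 0) (cmap c @` V) by exact: open_nbhs_nbhs.
have := ci _ (mem_set WO) N; rewrite -[in cinv c _]cO inv// => /(_ NO) N0.
have {}N0 : \forall q \near ((0, 0) : R * R), N (cinv c q) by exact: N0.
have : nbhs ((0, 0) : R * R) ((cmap c @` V) `&` (fun q => N (cinv c q))).
  exact: filterI.
move=> /nbhs_ballP[r r0 rP].
exists r => // a b ar br.
have [|[x Vx xE] Nx] := rP (a, b).
  by split; rewrite /ball /= sub0r normrN.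
by rewrite /pt /F /H -xE inv//; split => //; rewrite ?xE// -{1}(inv x)// xE.
Qed.

Let pt_cont a b : (cmap c @` V) (a, b) -> {for (a, b), continuous (Gl \o cinv c)}.
Proof.
move=> Wab; have [_ _ inv _ ci] := Vchart.
apply: continuous_comp; first exact: ci (mem_set Wab).
by case: Wab => x Vx <-; rewrite inv//; exact: Gl_cont (mem_set Vx).
Qed.

Let pt_in a b : V (pt a b) -> F (pt a b) = a -> H (pt a b) = b ->
  (cmap c @` V) (a, b).
Proof.
move=> Vp Fp Hp; exists (pt a b) => //.
by rewrite (surjective_pairing (cmap c _)) -/(F _) -/(H _) Fp Hp.
Qed.

(** The points [pt s 0] work, since [Gl] and [Gr] are continuous and vanish at [O]. They supply
    points of the box strictly on either side of [F = 0]. *)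
Let box_near_O : exists2 r : R, 0 < r & forall s, `|s| < r ->
  exists2 x, K x & F x = s.
Proof.
have Gcvg : \forall x \near O, `|Gl x| < delta'.
  apply: cvgr0_norm_lt d'0; rewrite -GlO.
  exact: Gl_cont (mem_set VO).
have GrO : Gr O = 0 by rewrite GrE// GlO FO maxxx mulr0 addr0.
have Gcvg' : \forall x \near O, `|Gr x| < delta'.
  apply: cvgr0_norm_lt d'0; rewrite -GrO.
  exact: Gr_cont (mem_set VO).
have [r r0 rP] := cvg_pt _ (filterI Gcvg Gcvg').
exists (Num.min r delta); first by rewrite lt_min r0.
move=> s; rewrite lt_min => /andP[sr sd].
have [//|Vp Fp _ [Glp Grp]] := rP s 0 sr; first by rewrite normr0.
exists (pt s 0) => //; split => //; rewrite ?Fp.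
- by move: sd; rewrite ltr_norml; lra.
- by move: Glp; rewrite /= ltr_norml; lra.
- by move: Grp; rewrite /= ltr_norml; lra.
Qed.

Let derive_vertical (u d : R) : is_derive ((0, u) : R * R) (0, 1) (Gl \o cinv c) d ->
  is_derive u 1 (fun h : R => Gl (pt 0 h)) d.
Proof.
move=> [dv dE].
have E : (fun h : R =>
    h^-1 *: (((fun h => Gl (pt 0 h)) \o shift u) (h *: 1) - Gl (pt 0 u))) =
  (fun h : R => h^-1 *: (((Gl \o cinv c) \o shift ((0, u) : R * R)) (h *: (0, 1))
    - (Gl \o cinv c) (0, u))).
  apply/funext => h /=; congr (_ *: (Gl (cinv c _) - _)).
  by apply/pair_equal_spec; rewrite /= scaler0 addr0.
by split; [rewrite /derivable E|rewrite /derive E].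
Qed.

(** On the line [F = 0] the derivative of [Gl] in [H] is positive except possibly at [O], so the
    mean value theorem makes [Gl] increase on each side of its zero at [O]. *)
Let vertical_sign : exists2 r, 0 < r & forall h, `|h| < r ->
  [/\ V (pt 0 h), F (pt 0 h) = 0, H (pt 0 h) = h,
      h < 0 -> Gl (pt 0 h) < 0 & 0 < h -> 0 < Gl (pt 0 h)].
Proof.
have [r r0 rP] := cvg_pt setT filterT; exists r => // h hr.
have inr u : `|u| < r -> [/\ V (pt 0 u), F (pt 0 u) = 0 & H (pt 0 u) = u].
  by move=> ur; have [|? ? ? _] := rP 0 u _ ur; rewrite ?normr0.
have [Vh Fh Hh] := inr h hr.
have pt0 : pt 0 0 = O.
  by have [|V0 F0 H0] := inr 0; rewrite ?normr0//; apply/Oeq.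
have dpos (u : R) : `|u| < r -> u != 0 -> exists2 d : R, 0 < d &
    is_derive u 1 (fun h : R => Gl (pt 0 h)) d.
  move=> ur u0; have [Vu Fu Hu] := inr u ur.
  have [|d d_gt0 dP] := dG _ Vu.
    by move=> uO; move: Hu u0; rewrite uO HO => <-; rewrite eqxx.
  exists d => //; apply: derive_vertical; move: dP.
  by rewrite (surjective_pairing (cmap c _)) -/(F _) -/(H _) Fu Hu.
have cont (u : R) : `|u| < r -> {for u, continuous (fun h => Gl (pt 0 h))}.
  move=> ur; have [Vu Fu Hu] := inr u ur.
  have := pt_cont _ _ (pt_in _ _ Vu Fu Hu).
  apply: (@continuous_comp _ _ _ (fun h : R => (0, h) : R * R)).
  apply: (@cvg_pair _ _ _ _ (nbhs (0 : R)) (nbhs u)); first exact: cvg_cst.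
  exact: cvg_id.
(* The derivative is known only off [O], so [0] must not lie strictly between [a] and [b]; as an
   endpoint it only needs continuity. *)
have incr (a b : R) : - r < a -> b < r -> a < b -> (b <= 0 \/ 0 <= a) ->
    Gl (pt 0 a) < Gl (pt 0 b).
  move=> ra rb ab ab0.
  have small u : u \in `[a, b] -> `|u| < r.
    by rewrite in_itv /= => /andP[? ?]; rewrite ltr_norml; apply/andP; split; lra.
  have [||w] := @MVT R (fun h => Gl (pt 0 h)) ('D_1 (fun h => Gl (pt 0 h))) a b ab.
  - move=> u uab; have [||d _ [dd _]] := dpos u.
    + by apply: small; apply: subset_itv_oo_cc uab.
    + by move: uab; rewrite in_itv /= => /andP[? ?]; apply/eqP => ?; case: ab0; lra.
    + exact/derivableP.
  - apply: continuous_in_subspaceT => u; rewrite inE /= => uab.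
    exact: cont (small u uab).
  - move=> wab E; rewrite -subr_gt0 E; apply: mulr_gt0; last by rewrite subr_gt0.
    have [||d d_gt0 [_ ->]//] := dpos w.
    + by apply: small; apply: subset_itv_oo_cc wab.
    + by move: wab; rewrite in_itv /= => /andP[? ?]; apply/eqP => ?; case: ab0; lra.
have G0 : Gl (pt 0 0) = 0 by rewrite pt0.
move: (hr); rewrite ltr_norml => /andP[h1 h2].
split=> // h0.
  by have := incr h 0 h1 r0 h0 (or_introl (lexx 0)); rewrite G0.
have nr0 : - r < 0 by lra.
by have := incr 0 h nr0 h2 h0 (or_intror (lexx 0)); rewrite G0.
Qed.

Let cvg_left (g : R) : (- s, g) @[s --> 0^'+] --> (0 : R, g).
Proof.
apply: (@cvg_pair _ _ _ _ (nbhs (0 : R)) (nbhs g)); last exact: cvg_cst.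
apply: cvg_at_right_filter; rewrite -[X in _ --> X]oppr0.
by apply: cvgN; exact: cvg_id.
Qed.

(** Away from [O] this is openness of a chart. Neither affine chart contains [O]; there [Gl] is
    negative at [pt (- s) (- h)] and positive at [pt (- s) h] for small [s], by continuity from
    [F = 0], and the intermediate value theorem gives a zero in between. *)
Let left_points x (N : set B) : V x -> F x = 0 -> nbhs x N ->
  \forall s \near 0^'+, exists y, [/\ V y, N y, F y = - s & Gl y = Gl x].
Proof.
move=> Vx Fx Nx.
have [xO|/(Ulr x Vx)[xU|xU]] := pselect (x = O).
- rewrite xO GlO in Nx *.
  have [r1 r10 r1P] := cvg_pt _ Nx.
  have [r2 r20 r2P] := vertical_sign.
  pose h := Num.min r1 r2 / 2.
  have h0 : 0 < h by rewrite divr_gt0 // lt_min r10.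
  have [hr1 hr2] : h < r1 /\ h < r2.
    have : Num.min r1 r2 <= r1 by rewrite ge_min lexx.
    have : Num.min r1 r2 <= r2 by rewrite ge_min lexx orbT.
    by rewrite /h in h0 *; split; lra.
  have hn : `|h| = h by rewrite gtr0_norm.
  have hN : `|- h| = h by rewrite normrN.
  have cG (u : R) : `|u| = h -> Gl (pt (- s) u) @[s --> 0^'+] --> Gl (pt 0 u).
    move=> uh; have [|Vu Fu Hu _ _] := r2P u; first by rewrite uh.
    exact: (cvg_comp _ _ (cvg_left u) (pt_cont _ _ (pt_in _ _ Vu Fu Hu))).
  have lo : \forall s \near 0^'+, Gl (pt (- s) (- h)) < 0.
    have [|_ _ _ Gn _] := r2P (- h); first by rewrite hN.
    by apply: (cvgr_lt _ (cG _ hN)); apply: Gn; rewrite oppr_lt0.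
  have up : \forall s \near 0^'+, 0 < Gl (pt (- s) h).
    have [|_ _ _ _ Gp] := r2P h; first by rewrite hn.
    by apply: (cvgr_gt _ (cG _ hn)); exact: Gp.
  near=> s.
  have s0 : 0 < s by near: s; exact: nbhs_right_gt.
  have sr : `|- s| < r1.
    by rewrite normrN gtr0_norm//; near: s; exact: nbhs_right_lt.
  have inh (u : R) : `|u| <= h ->
      [/\ V (pt (- s) u), F (pt (- s) u) = - s, H (pt (- s) u) = u & N (pt (- s) u)].
    by move=> uh; apply: r1P => //; exact: le_lt_trans hr1.
  have [|||u uh Gu] := @IVT R (fun u => Gl (pt (- s) u)) (- h) h 0.
  + lra.
  + apply: continuous_in_subspaceT => u; rewrite inE /= in_itv /= -ler_norml => uh.
    have [Vu Fu Hu _] := inh u uh.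
    have := pt_cont _ _ (pt_in _ _ Vu Fu Hu).
    apply: (@continuous_comp _ _ _ (fun h : R => (- s, h) : R * R)).
    apply: (@cvg_pair _ _ _ _ (nbhs (- s)) (nbhs u)); first exact: cvg_cst.
    exact: cvg_id.
  + rewrite ge_min le_max; apply/andP; split; apply/orP.
    * by left; apply: ltW; near: s.
    * by right; apply: ltW; near: s.
  + have [|Vu Fu Hu Nu] := inh u; first by move: uh; rewrite in_itv /= -ler_norml.
    by exists (pt (- s) u).
- have := smooth_coordinates_near Ul_sc x N xU Nx; rewrite Fx => /cvg_left near_s.
  have {}near_s : \forall s \near 0^'+,
    exists y, [/\ Ul y, N y, F y = - s & Gl y = Gl x] by exact: near_s.
  by apply: filterS near_s => s [y [[Vy _] ? ? ?]]; exists y.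
- have := smooth_coordinates_near Ur_sc x N xU Nx; rewrite Fx => /cvg_left near_s.
  have {}near_s : \forall s \near 0^'+,
    exists y, [/\ Ur y, N y, F y = - s & Gr y = Gr x] by exact: near_s.
  apply: filterS2 near_s (nbhs_right_gt 0) => s [y [[Vy _] Ny Fy Gy]] s0.
  exists y; split => //.
  (* The chart [Ur] preserves the value of [Gr], which equals [Gl] where [F <= 0]. *)
  move: Gy; rewrite !GrE// Fy Fx maxxx max_r; last lra.
  by rewrite mulr0 !addr0.
Unshelve. all: by end_near. Qed.

(** * [Phi] is a bijection from the box onto the convex set [Q] *)

Let Q_convex a b t : Q a -> Q b -> 0 <= t <= 1 ->
  Q (a.1 + t * (b.1 - a.1), a.2 + t * (b.2 - a.2)).
Proof.
move=> [/andP[a1 a1'] a2 a3] [/andP[b1 b1'] b2 b3] /andP[t0 t1]; split => /=.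
- by apply/andP; split; nra.
- by nra.
(* The only nonlinear constraint of [Q] bounds a convex function from above: the positive part is
   convex and [k] is positive. *)
have M : Num.max (a.1 + t * (b.1 - a.1)) 0 <=
    Num.max a.1 0 + t * (Num.max b.1 0 - Num.max a.1 0).
  have ma : 0 <= Num.max a.1 0 by rewrite le_max lexx orbT.
  have mb : 0 <= Num.max b.1 0 by rewrite le_max lexx orbT.
  have ma' : a.1 <= Num.max a.1 0 by rewrite le_max lexx.
  have mb' : b.1 <= Num.max b.1 0 by rewrite le_max lexx.
  by rewrite ge_max; apply/andP; split; nra.
have kM := ler_wpM2l (ltW k0) M.
move: a3 b3 kM; move: (Num.max _ _) (Num.max _ _) (Num.max _ _) => *; nra.
Qed.

Let hausR2 : hausdorff_space (R * R)%type.
Proof. exact: (@norm_hausdorff R (R * R)%type). Qed.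

(* Along a segment of Q off the line q.1 = 0, the points reached by Phi form an
   open set, because Ul is a chart, and a closed one, because K is compact. *)
Let surj_off0 q : Q q -> q.1 != 0 -> exists2 x, K x & Phi x = q.
Proof.
move=> Qq q0.
have [r r0 rP] := box_near_O.
(* The starting point is on the same side as [q], so the segment joining them never meets
   [q.1 = 0]. *)
have [x0 Kx0 sgn] : exists2 x0, K x0 & 0 < F x0 * q.1.
  have [q1|q1] := ltP q.1 0.
    have [|x Kx Fx] := rP (- (r / 2)); first by rewrite normrN gtr0_norm; lra.
    by exists x => //; rewrite Fx; nra.
  have [|x Kx Fx] := rP (r / 2); first by rewrite gtr0_norm; lra.
  exists x => //; rewrite Fx; apply: mulr_gt0; first lra.
  by rewrite lt_neqAle eq_sym q0.
pose p t := (F x0 + t * (q.1 - F x0), Gl x0 + t * (q.2 - Gl x0)).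
have Qx0 : Q (Phi x0) by have [] := (KE x0).1 Kx0.
have pQ t : 0 <= t <= 1 -> Q (p t) by move=> t01; exact: (Q_convex (Phi x0) q).
have p0 t : 0 <= t <= 1 -> (p t).1 != 0.
  move=> /andP[t0 t1]; rewrite /=; apply/eqP => E.
  have qq : 0 < q.1 * q.1 by rewrite -expr2 exprn_even_gt0.
  have : 0 < (F x0 + t * (q.1 - F x0)) * q.1.
    rewrite mulrDl -mulrA mulrBl.
    by apply: convex_gt0; [exact: ltW|exact: qq|rewrite t0|left].
  by rewrite E mul0r ltxx.
have pc : continuous p.
  move=> t; apply: (@cvg_pair _ _ _ _ (nbhs _) (nbhs _));
    by apply: cvgD; [exact: cvg_cst|apply: cvgM; [exact: cvg_id|exact: cvg_cst]].
have oUl : open (Phi @` Ul).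
  rewrite openE => _ [x xU <-].
  change (\forall q \near Phi x, (Phi @` Ul) q).
  apply: filterS (smooth_coordinates_near Ul_sc x setT xU filterT).
  move=> -[a b] [y [yU _ ya yb]]; exists y => //.
  by rewrite /Phi ya yb.
have clK : closed (Phi @` K).
  by apply: (compact_closed hausR2); exact: continuous_compact.
have KU t : 0 <= t <= 1 -> (Phi @` Ul) (p t) -> (Phi @` K) (p t).
  move=> t01 [x [Vx _] xE]; exists x => //; apply/KE; split => //.
  by rewrite xE; exact: pQ.
have KU' t : 0 <= t <= 1 -> (Phi @` K) (p t) -> (Phi @` Ul) (p t).
  move=> t01 [x /KE[Vx _] xE]; exists x => //; apply: Ul_F => //.
  by have := p0 t t01; rewrite -xE.
have : `[0, 1]%classic `&` (p @^-1` (Phi @` K)) = `[0, 1]%classic.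
  have /connected_intervalP := @interval_is_interval R `[0, 1]; apply.
  - exists 0; split; first by rewrite /= in_itv /= lexx ler01.
    by exists x0 => //; rewrite /p !mul0r !addr0.
  - exists (p @^-1` (Phi @` Ul)); first by apply: open_comp => // t _; exact: pc.
    by apply/seteqP; split => t [t01 pt01]; split => //;
      [apply: KU'|apply: KU] => //; move: t01; rewrite /= in_itv.
  - exists (p @^-1` (Phi @` K)) => //.
    by apply: closed_comp => // t _; exact: pc.
move=> /seteqP[_ /(_ 1)]; case; first by rewrite /= in_itv /= ler01 lexx.
move=> _ [x Kx xE]; exists x => //; rewrite xE /p !mul1r.
by rewrite ![_ + (_ - _)]addrC !subrK -surjective_pairing.
Qed.

Let Q_left s g : 0 < s <= delta -> - delta' <= g <= delta' -> Q (- s, g).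
Proof.
move=> s01 g01; split => /=; [lra|lra|].
by rewrite max_r ?mulr0 ?addr0; lra.
Qed.

(** A point with [q.1 = 0] is the limit of the points [(- s, q.2)], which stay in [Q] because the
    positive part vanishes on the left. The image of the compact box is closed. *)
Let surj q : Q q -> exists2 x, K x & Phi x = q.
Proof.
move=> Qq; have [q0|] := eqVneq q.1 0; last exact: surj_off0.
suff [x Kx xE] : (Phi @` K) q by exists x.
have clK : closed (Phi @` K).
  by apply: (compact_closed hausR2); exact: continuous_compact.
apply: clK => N Nq.
have g01 : - delta' <= q.2 <= delta'.
  by case: Qq; rewrite q0 maxxx mulr0 addr0 => _ -> ->.
have Ns : \forall s \near 0^'+, N (- s, q.2).
  by apply: cvg_left; rewrite -q0 -surjective_pairing.
near (0 : R)^'+ => s.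
have s0 : 0 < s by near: s; exact: nbhs_right_gt.
have sd : s <= delta by near: s; exact: nbhs_right_le.
exists (- s, q.2); split; last by near: s.
have [|/= |x Kx xE] := surj_off0 (- s, q.2).
- by apply: Q_left; rewrite ?s0.
- by rewrite oppr_eq0 gt_eqF.
- by exists x.
Unshelve. all: by end_near. Qed.

(** Off [F = 0] the chart [Ul] separates points. Over [F = 0], disjoint neighborhoods of [x] and [y]
    would contain points with equal [Gl] and equal [F = - s], which coincide by the first case. *)
Let PhiK_inj : set_inj K Phi.
Proof.
move=> x y /set_mem/KE[Vx Qx] /set_mem/KE[Vy Qy] [Fxy Gxy].
have [F0|F0] := eqVneq (F x) 0; last first.
  by apply: (smooth_coordinates_inj Ul_sc) => //; apply: Ul_F; rewrite -?Fxy.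
apply: contrapT => /eqP xy.
have := @surface_hausdorff R B; rewrite open_hausdorff => /(_ x y xy).
move=> [[M N] /= [/set_mem Mx /set_mem Ny] [oM oN /eqP MN]].
have nx := left_points x M Vx F0 (open_nbhs_nbhs (conj oM Mx)).
have ny := left_points y N Vy (etrans (esym Fxy) F0) (open_nbhs_nbhs (conj oN Ny)).
near (0 : R)^'+ => s.
have s0 : 0 < s by near: s; exact: nbhs_right_gt.
have [x' [Vx' Mx' Fx' Gx']] : exists y, [/\ V y, M y, F y = - s & Gl y = Gl x].
  by near: s.
have [y' [Vy' Ny' Fy' Gy']] : exists z, [/\ V z, N z, F z = - s & Gl z = Gl y].
  by near: s.
have : (M `&` N) x'.
  split => //; suff -> : x' = y' by [].
  apply: (smooth_coordinates_inj Ul_sc); rewrite ?Fx' ?Fy' ?Gx' ?Gy'//;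
    by apply: Ul_F => //; rewrite ?Fx' ?Fy' oppr_eq0 gt_eqF.
by rewrite MN.
Unshelve. all: by end_near. Qed.

(** * The inverse of [Phi] on [Q], and lifted segments *)

Let psi q := xget O [set x | K x /\ Phi x = q].

Let psiP q : Q q -> K (psi q) /\ Phi (psi q) = q.
Proof.
move=> /surj[x Kx xE].
by apply: (@xgetPex _ O [set x | K x /\ Phi x = q]); exists x.
Qed.

Let Phi_psi q : Q q -> [/\ V (psi q), F (psi q) = q.1, Gl (psi q) = q.2 &
  Gr (psi q) = q.2 + k * Num.max q.1 0].
Proof.
move=> /psiP[/KE[Vq _] Pq].
have Fq : F (psi q) = q.1 := congr1 fst Pq.
have Gq : Gl (psi q) = q.2 := congr1 snd Pq.
by split => //; rewrite GrE// Fq Gq.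
Qed.

Let psiK x : K x -> psi (Phi x) = x.
Proof.
move=> Kx; have [|Kp Pp] := psiP (Phi x); first by case/KE: Kx.
by apply: PhiK_inj => //; exact: mem_set.
Qed.

Let KO : K O.
Proof.
apply/KE; split => //; rewrite /Phi FO GlO; split => /=.
- by rewrite oppr_le0 !ltW.
- by rewrite oppr_le0 ltW.
- by rewrite maxxx mulr0 addr0 ltW.
Qed.

Let psi_continuous (I : set R) (p : R -> R * R) :
  (forall t, I t -> Q (p t)) -> continuous p -> {within I, continuous (psi \o p)}.
Proof.
move=> Qp pc.
apply: (compact_inj_path_continuous _ _ _ _ hausR2 cK PhiK PhiK_inj _ _ _ p).
- by move=> t /Qp/psiP[].
- by move=> t /Qp/psiP[].
- by move=> t _; exact: pc.
Qed.

Let seg (a b : R * R) (t : R) := (a.1 + t * (b.1 - a.1), a.2 + t * (b.2 - a.2)).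

Let seg_continuous a b : continuous (seg a b).
Proof.
move=> t; apply: (@cvg_pair _ _ _ _ (nbhs _) (nbhs _));
  by apply: cvgD; [exact: cvg_cst|apply: cvgM; [exact: cvg_id|exact: cvg_cst]].
Qed.

Let seg0 a b : seg a b 0 = a.
Proof. by rewrite /seg !mul0r !addr0 -surjective_pairing. Qed.

Let seg1 a b : seg a b 1 = b.
Proof.
by rewrite /seg !mul1r ![_ + (_ - _)]addrC !subrK -surjective_pairing.
Qed.

Let Q0 x : K x -> Q (Phi x). Proof. by case/KE. Qed.

Let I01 : set R := `[0, 1].

Let inI t : I01 t <-> 0 <= t <= 1.
Proof. by rewrite /I01 /= in_itv. Qed.

Let I0 : I01 0. Proof. by apply/inI; rewrite lexx ler01. Qed.

Let I1 : I01 1. Proof. by apply/inI; rewrite lexx ler01. Qed.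

Let Q_seg a b t : Q a -> Q b -> I01 t -> Q (seg a b t).
Proof. by move=> Qa Qb /inI; exact: Q_convex. Qed.

(* Decides which of Ul and Ur contains a point with F = 0, given its G. *)
Let Gl_mul_H x : K x -> F x = 0 -> x <> O -> 0 < Gl x * H x.
Proof.
move=> Kx Fx xO; have [Vx Qx] := (KE x).1 Kx.
have Gx : Gl x != 0.
  apply/eqP => Gx; apply: xO; apply: PhiK_inj; rewrite ?inE//.
  by rewrite /Phi Fx Gx FO GlO.
rewrite ltNge; apply/negP => GH.
have [r r0 rP] := vertical_sign.
have Gsmall : \forall x \near O, `|Gl x| < delta'.
  by apply: cvgr0_norm_lt d'0; rewrite -GlO; exact: Gl_cont (mem_set VO).
have [r' r'0 rP'] := cvg_pt _ Gsmall.
pose m := Num.min r r' / 2.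
have m0 : 0 < m by rewrite divr_gt0 // lt_min r0.
have mr : m < r /\ m < r'.
  have : Num.min r r' <= r by rewrite ge_min lexx.
  have : Num.min r r' <= r' by rewrite ge_min lexx orbT.
  by rewrite /m in m0 *; split; lra.
(* A reference point over [F = 0], close to [O], whose [Gl] has the sign of [Gl x]; there
   [vertical_sign] gives [H] that sign too. *)
have [y [Ky Fy Gy Hy]] : exists y, [/\ K y, F y = 0, 0 < Gl x * Gl y & 0 < Gl x * H y].
  have inK h : `|h| = m -> [/\ K (pt 0 h), F (pt 0 h) = 0, H (pt 0 h) = h,
      h < 0 -> Gl (pt 0 h) < 0 & 0 < h -> 0 < Gl (pt 0 h)].
    move=> hm; have [|Vh Fh Hh Gn Gp] := rP h; first by rewrite hm; case: mr.
    have [|| _ _ _ Gs] := rP' 0 h; rewrite ?normr0 ?hm//; first by case: mr.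
    split => //; apply/KE; split => //.
    move: Gs; rewrite /Phi Fh /= ltr_norml => /andP[? ?]; split => /=.
    - by rewrite oppr_le0 !ltW.
    - exact: ltW.
    - by rewrite maxxx mulr0 addr0 ltW.
  have [Gx0|Gx0] := ltP (Gl x) 0.
    have [|Kh Fh Hh Gn _] := inK (- m); first by rewrite normrN gtr0_norm.
    have Gh : Gl (pt 0 (- m)) < 0 by apply: Gn; lra.
    by exists (pt 0 (- m)); split => //; rewrite ?Hh nmulr_rgt0//; lra.
  have Gx0' : 0 < Gl x by rewrite lt_neqAle eq_sym Gx.
  have [|Kh Fh Hh _ Gp] := inK m; first by rewrite gtr0_norm.
  by exists (pt 0 m); split => //; rewrite ?Hh; apply: mulr_gt0 => //; exact: Gp.
pose p := seg (Phi x) (Phi y).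
have Qp t : I01 t -> Q (p t) by apply: Q_seg; exact: Q0.
(* If [H x] had the wrong sign, [H] would vanish somewhere on the lifted segment from [x] to [y].
   Such a point has [F = H = 0], so it is [O], yet [Gl] keeps a nonzero sign along the segment. *)
have [t /= t01 Ht] : exists2 t, t \in `[0, 1] & Gl x * H (psi (p t)) = 0.
  apply: (@IVT R (fun t => Gl x * H (psi (p t)))) => //.
    apply/subspace_continuousP => t It.
    have [Vt _ _ _] := Phi_psi _ (Qp t It).
    have /subspace_continuousP/(_ t It) pc :=
      psi_continuous I01 p Qp (seg_continuous _ _).
    have [_ _ _ cc _] := Vchart.
    have Hc : H y @[y --> psi (p t)] --> H (psi (p t)).
      apply: (cvg_comp _ _ (cc _ (mem_set Vt))).
      exact: (@cvg_snd _ _ (nbhs (cmap c _).1) (nbhs (cmap c _).2) _).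
    by apply: cvgM; [exact: cvg_cst|exact: (cvg_comp _ _ pc Hc)].
  rewrite /p seg0 seg1 !psiK// ge_min le_max; apply/andP; split; apply/orP; [left|right] => //.
  exact: ltW.
have It : I01 t by [].
have [Vt Ft Gt _] := Phi_psi _ (Qp t It).
have tO : psi (p t) = O.
  apply/Oeq => //; split; first by rewrite Ft /p /= Fx Fy; lra.
  by move/eqP: Ht; rewrite mulf_eq0 (negbTE Gx) => /eqP.
have : 0 < Gl x * (p t).2.
  move/inI: It => /andP[t0 t1]; rewrite /p /=.
  have gg : 0 < Gl x * Gl x by rewrite -expr2 exprn_even_gt0.
  rewrite mulrDr mulrCA mulrBr.
  by apply: convex_gt0; [exact: ltW|by []|rewrite t0|left].
by rewrite -Gt tO GlO mulr0 ltxx.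
Qed.

(** * Straight lines obtained from paths in [Q] *)

Let seg_affine (I : set R) a b :
  affine_along R I (fun t => (seg a b t).1) /\ affine_along R I (fun t => (seg a b t).2).
Proof.
by split; [exists (b.1 - a.1), a.1|exists (b.2 - a.2), a.2] => t _ /=; ring.
Qed.

Let continuous_R2 (f g : R -> R) :
  continuous f -> continuous g -> continuous (fun t => (f t, g t)).
Proof.
by move=> fc gc t; apply: (@cvg_pair _ _ _ _ (nbhs _) (nbhs _)); [exact: fc|exact: gc].
Qed.

Let affine_along_ext (I : set R) (f g : R -> R) :
  affine_along R I f -> (forall t, I t -> g t = f t) -> affine_along R I g.
Proof. by move=> [a [b fE]] gf; exists a, b => t It; rewrite gf// fE. Qed.

(** The path is given in the coordinates [(F, Gl)]; the expression with [k] is the value of [Gr] at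
    the lifted point. The chart may change from point to point. *)
Let regular_path (p : R -> R * R) :
  continuous p -> (forall t, I01 t -> Q (p t)) ->
  affine_along R I01 (fun t => (p t).1) ->
  (forall t, I01 t ->
    (Ul (psi (p t)) /\ affine_along R I01 (fun t => (p t).2)) \/
    (Ur (psi (p t)) /\
     affine_along R I01 (fun t => (p t).2 + k * Num.max (p t).1 0))) ->
  regular_straight_line I01 (psi \o p).
Proof.
move=> pc Qp paff loc; apply: regular_straight_line_local.
- exact: interval_is_interval.
- exact: psi_continuous.
have Faff : affine_along R I01 (F \o (psi \o p)).
  by apply: affine_along_ext paff _ => t /Qp/Phi_psi[].
move=> t It; case: (loc t It) => -[U gaff].
- exists Ul, F, Gl; split => //.
  by apply: affine_along_ext gaff _ => u /Qp/Phi_psi[].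
- exists Ur, F, Gr; split => //.
  by apply: affine_along_ext gaff _ => u /Qp/Phi_psi[].
Qed.

(** Both half-planes are closed, so a failure of this relation means strictly opposite signs. *)
Let same_side (a b : R * R) := (a.1 <= 0 /\ b.1 <= 0) \/ (0 <= a.1 /\ 0 <= b.1).

(** On one closed side the positive part is linear, so [Gl] and [Gr] are both affine along the
    segment. A segment avoiding the origin lifts to points of [Ul] or [Ur]. *)
Let regular_same_side a b : Q a -> Q b -> same_side a b ->
  (forall t, I01 t -> seg a b t <> (0, 0)) ->
  regular_straight_line I01 (psi \o seg a b).
Proof.
move=> Qa Qb ab nO; have [aff1 aff2] := seg_affine I01 a b.
apply: regular_path => //.
- by move=> t It; exact: Q_seg.
move=> t It; have Qt := Q_seg _ _ _ Qa Qb It.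
have [Vt Ft Gt _] := Phi_psi _ Qt.
have tO : psi (seg a b t) <> O.
  move=> E; apply: (nO t It).
  by rewrite (surjective_pairing (seg a b t)) -Ft -Gt E FO GlO.
have [tU|tU] := Ulr _ Vt tO; [left|right]; split => //.
case: ab => -[a0 b0].
- apply: (affine_along_ext _ _ _ aff2) => u /inI u01.
  rewrite max_r ?mulr0 ?addr0//= -oppr_ge0.
  have -> : - (a.1 + u * (b.1 - a.1)) = - a.1 + u * (- b.1 - - a.1) by ring.
  by apply: convex_ge0 => //; rewrite oppr_ge0.
- case: aff1 aff2 => [a1 [b1 E1]] [a2 [b2 E2]].
  exists (a2 + k * a1), (b2 + k * b1) => u Iu.
  rewrite max_l; first by rewrite E1// E2//; ring.
  by move/inI : Iu => u01; exact: convex_ge0.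
Qed.

Let seg_pos a b t : 0 <= a.1 -> 0 < b.1 -> I01 t -> 0 < a.1 \/ 0 < t ->
  0 < (seg a b t).1.
Proof. by move=> a0 b0 /inI t01 at0; exact: convex_gt0. Qed.

Let seg_neg a b t : a.1 <= 0 -> b.1 < 0 -> I01 t -> a.1 < 0 \/ 0 < t ->
  (seg a b t).1 < 0.
Proof.
move=> a0 b0 /inI t01 at0; rewrite -oppr_gt0 /=.
have -> : - (a.1 + t * (b.1 - a.1)) = - a.1 + t * (- b.1 - - a.1) by ring.
by apply: convex_gt0 => //; rewrite ?oppr_ge0 ?oppr_gt0.
Qed.

(** Here [z] is the image of a box point strictly on the common side; moving both endpoints toward
    it by a fraction [e] pushes the whole segment off the line. *)
Let Q_off0 a b : same_side a b -> exists2 z, Q z & forall e, 0 < e <= 1 ->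
  same_side (seg a z e) (seg b z e) /\
  forall t, I01 t -> (seg (seg a z e) (seg b z e) t).1 != 0.
Proof.
move=> ab; have [r r0 rP] := box_near_O; case: ab => -[a0 b0].
- have [|x Kx Fx] := rP (- (r / 2)); first by rewrite normrN gtr0_norm; lra.
  have x0 : F x < 0 by rewrite Fx; lra.
  exists (Phi x) => [|e /andP[e0 e1]]; first exact: Q0.
  have Ie : I01 e by apply/inI; rewrite ltW.
  have A (y : R * R) : y.1 <= 0 -> (seg y (Phi x) e).1 < 0.
    by move=> y0; apply: seg_neg => //; right.
  have Aa := A a a0; have Ab := A b b0.
  split; first by left; rewrite !ltW.
  by move=> t It; rewrite lt_eqF// seg_neg//; [exact: ltW|left].
- have [|x Kx Fx] := rP (r / 2); first by rewrite gtr0_norm; lra.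
  have x0 : 0 < F x by rewrite Fx; lra.
  exists (Phi x) => [|e /andP[e0 e1]]; first exact: Q0.
  have Ie : I01 e by apply/inI; rewrite ltW.
  have A (y : R * R) : 0 <= y.1 -> 0 < (seg y (Phi x) e).1.
    by move=> y0; apply: seg_pos => //; right.
  have Aa := A a a0; have Ab := A b b0.
  split; first by right; rewrite !ltW.
  by move=> t It; rewrite gt_eqF// seg_pos//; [exact: ltW|left].
Qed.

Let singular_same_side a b t : Q a -> Q b -> same_side a b -> a <> b ->
  I01 t -> seg a b t = (0, 0) ->
  singular_straight_line I01 (psi \o seg a b).
Proof.
move=> Qa Qb ab anb It tO; have Qs u : I01 u -> Q (seg a b u) by exact: Q_seg.
split.
- exact: interval_is_interval.
- exact: psi_continuous.
- exists 0, 1; split; [exact: I0|exact: I1|].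
  rewrite /= seg0 seg1 => E; apply: anb.
  by have [_ <-] := psiP a Qa; rewrite E; have [_ ->] := psiP b Qb.
- exists t => //=; exists k, c, Gl, Gr; suff -> : psi (seg a b t) = O by [].
  by rewrite tO -(psiK O KO) /Phi FO GlO.
move=> t0; rewrite interior_itv /= in_itv /= => t01; exists 0, 1; split => //.
have [z Qz z0] := Q_off0 a b ab.
(* The fraction [harmonic n], equal to [1/(n+1)], lies in [(0, 1]] and tends to [0], so these
   segments avoid the line and converge to the given one. *)
pose p n := seg (seg a z (harmonic n)) (seg b z (harmonic n)).
have hn n : 0 < (harmonic n : R) <= 1.
  by rewrite harmonic_gt0 /= invf_le1 ?ler1n ?ltr0n.
have Qn a' n : Q a' -> Q (seg a' z (harmonic n)).
  by move=> Qa'; apply: Q_seg => //; apply/inI; have /andP[/ltW -> ->] := hn n.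
exists (fun n => psi \o p n).
- move=> n; have [side n0] := z0 _ (hn n).
  apply: regular_same_side; [exact: Qn|exact: Qn|exact: side|].
  by move=> u Iu E; have := n0 u Iu; rewrite E eqxx.
- apply: (compact_inj_uniform_limit _ _ _ K Phi _ _ _ _ p (seg a b) hausR2 cK PhiK PhiK_inj).
  + by move=> u /inI Iu; apply: psiP; exact: Qs.
  + by move=> n u /inI Iu; apply: psiP; apply: Q_seg => //; exact: Qn.
  + move=> u _.
    have cu : q.1 @[q --> (u, \oo)] --> u by exact: cvg_fst.
    have ch : (harmonic q.2 : R) @[q --> (u, \oo)] --> (0 : R).
      exact: (cvg_comp _ _ cvg_snd cvg_harmonic).
    have cc (y1 y2 : R) : y1 + harmonic q.2 * (y2 - y1) @[q --> (u, \oo)] --> y1.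
      have : y1 + harmonic q.2 * (y2 - y1) @[q --> (u, \oo)] --> y1 + 0 * (y2 - y1).
        by apply: cvgD; [exact: cvg_cst|apply: cvgM; [exact: ch|exact: cvg_cst]].
      by rewrite mul0r addr0.
    apply: (@cvg_pair _ _ _ _ (nbhs _) (nbhs _)) => /=;
      by apply: cvgD; [exact: cc|apply: cvgM; [exact: cu|apply: cvgB; exact: cc]].
Qed.

(** The disjunction excludes just the constant path at [O]: a singular line must be non-constant,
    while a constant path elsewhere is regular. *)
Let same_side_line a b : Q a -> Q b -> same_side a b ->
  a <> b \/ a <> (0, 0) -> straight_line I01 (psi \o seg a b).
Proof.
move=> Qa Qb ab anb.
have [[t It tO]|nO] := pselect (exists2 t, I01 t & seg a b t = (0, 0)).
  right; apply: (singular_same_side a b t) => //.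
  case: anb => // a0 E; apply: a0.
  by rewrite -E /seg !subrr !mulr0 !addr0 -surjective_pairing in tO.
left; apply: regular_same_side => // t It tO; apply: nO; by exists t.
Qed.

Let crossing_line x y : K x -> K y -> F x < 0 -> 0 < F y ->
  exists p : R -> R * R, [/\ p 0 = Phi x, p 1 = Phi y,
    forall t, I01 t -> Q (p t) & regular_straight_line I01 (psi \o p)].
Proof.
move=> Kx Ky x0 y0.
have [Vx Qx] := (KE x).1 Kx; have [Vy Qy] := (KE y).1 Ky.
have D0 : 0 < F y - F x by lra.
(* The time at which [F] vanishes, common to the segments in [(F, Gl)] and in [(F, Gr)]. *)
pose s := - F x / (F y - F x).
have s0 : 0 < s by apply: divr_gt0; lra.
have sE t : F x + t * (F y - F x) = 0 -> t = s.
  move=> E; apply: (mulIf (lt0r_neq0 D0)).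
  by rewrite /s divfK ?lt0r_neq0//; lra.
have [aff1 aff2] := seg_affine I01 (Phi x) (Phi y).
have UF q : Q q -> q.1 != 0 -> Ul (psi q) /\ Ur (psi q).
  move=> /Phi_psi[Vq Fq _ _] q0.
  by split; split => // -[]; rewrite Fq => /eqP; rewrite (negbTE q0).
have HG q : Q q -> q.1 = 0 -> q.2 != 0 -> 0 < q.2 * H (psi q).
  move=> Qq q0 q2; have [Kp _] := psiP q Qq; have [_ Fq <- _] := Phi_psi q Qq.
  apply: Gl_mul_H => //; first by rewrite Fq.
  by move=> E; move: q2; have [_ _ <- _] := Phi_psi q Qq; rewrite E GlO eqxx.
have [gl|gl] := ltP (Gl x + s * (Gl y - Gl x)) 0.
- exists (seg (Phi x) (Phi y)); split.
  + exact: seg0.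
  + exact: seg1.
  + by move=> t; exact: Q_seg.
  apply: regular_path => //; first by move=> t; exact: Q_seg.
  move=> t It; left; split => //.
  have Qt := Q_seg _ _ _ Qx Qy It.
  have [t0|/(UF _ Qt)[]//] := eqVneq (seg (Phi x) (Phi y) t).1 0.
  have g0 : (seg (Phi x) (Phi y) t).2 < 0 by rewrite /= (sE t t0).
  have := HG _ Qt t0 (ltr0_neq0 g0); rewrite nmulr_rgt0// => Hn.
  by split; [case: (Phi_psi _ Qt)|move=> [_]; rewrite leNgt Hn].
- have Grx : Gr x = Gl x by rewrite GrE// max_r ?mulr0 ?addr0// ltW.
  have Gry : Gr y = Gl y + k * F y by rewrite GrE// max_l// ltW.
  pose q := seg (F x, Gr x) (F y, Gr y).
  have qc : continuous q by exact: seg_continuous.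
  (* The segment [q] of the [(F, Gr)] plane, rewritten in [(F, Gl)]. It becomes a broken line, so
     convexity of [Q] does not directly place it in [Q]. *)
  pose p t := ((q t).1, (q t).2 - k * Num.max (q t).1 0).
  have Qp t : I01 t -> Q (p t).
    move=> It; case: Qx Qy => /= Fx G1 G2 [/= Fy G1' G2']; split => /=.
    - by have := Q_seg _ _ _ (Q0 x Kx) (Q0 y Ky) It; case.
    (* For the lower bound where [F >= 0]: there [p] lies above the [(F, Gl)] segment by exactly
       this quantity. *)
    - have kx : 0 <= k * (- F x) * (1 - t).
        by move/inI : It => /andP[_ t1]; rewrite !mulr_ge0 ?(ltW k0)//; lra.
      have ky : 0 <= k * F y by rewrite mulr_ge0 // ltW.
      have [f0|f0] := ltP (F x + t * (F y - F x)) 0.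
      + rewrite mulr0 subr0 Grx Gry.
        have := @convex_ge0 R (Gl x + delta') (Gl y + k * F y + delta') t.
        by move/inI : It => It /(_ _ _ It); lra.
      + rewrite Grx Gry.
        have := @convex_ge0 R (Gl x + delta') (Gl y + delta') t.
        by move/inI : It => It /(_ _ _ It); lra.
    - rewrite subrK Grx Gry.
      move: G2 G2'; rewrite max_r ?(ltW x0)// max_l ?(ltW y0)// mulr0 addr0 => G2 G2'.
      have := @convex_ge0 R (delta' - Gl x) (delta' - (Gl y + k * F y)) t.
      by move/inI : It => It /(_ _ _ It); lra.
  exists p; split => //.
  + by rewrite /p /q seg0 /= Grx max_r ?mulr0 ?subr0// ltW.
  + by rewrite /p /q seg1 /= Gry max_l ?addrK// ltW.
  apply: regular_path => //.
  + apply: continuous_R2 => t.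
      exact: (cvg_comp _ _ (qc t) (@cvg_fst _ _ (nbhs (q t).1) (nbhs (q t).2) _)).
    have q1 : (q u).1 @[u --> t] --> (q t).1.
      exact: (cvg_comp _ _ (qc t) (@cvg_fst _ _ (nbhs (q t).1) (nbhs (q t).2) _)).
    have q2 : (q u).2 @[u --> t] --> (q t).2.
      exact: (cvg_comp _ _ (qc t) (@cvg_snd _ _ (nbhs (q t).1) (nbhs (q t).2) _)).
    apply: cvgB => //; apply: cvgM; first exact: cvg_cst.
    apply: (@continuous_max _ _ (fun u => (q u).1) (fun=> 0)); first exact: q1.
    exact: cvg_cst.
  + move=> t It; right; have Qt := Qp t It; split; last first.
      have [_ aff] := seg_affine I01 (F x, Gr x) (F y, Gr y).
      by apply: affine_along_ext aff _ => u _; rewrite subrK.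
    have [t0|/(UF _ Qt)[]//] := eqVneq (p t).1 0.
    (* At the crossing, [q] is higher than the [(F, Gl)] segment by [s * (k * F y)], which is
       positive. *)
    have g0 : 0 < (p t).2.
      have q0 : (q t).1 = 0 by [].
      rewrite /p q0 maxxx mulr0 subr0 /= (sE t q0) Grx Gry.
      have -> : Gl x + s * (Gl y + k * F y - Gl x) =
        Gl x + s * (Gl y - Gl x) + s * (k * F y) by ring.
      by apply: ltr_wpDl; [exact: gl|apply: mulr_gt0 => //; exact: mulr_gt0].
    have := HG _ Qt t0 (lt0r_neq0 g0); rewrite pmulr_rgt0// => Hn.
    by split; [case: (Phi_psi _ Qt)|move=> [_]; rewrite leNgt Hn].
Qed.

(** * Joining two points of the box *)

Let convex_same_side x y : K x -> K y -> same_side (Phi x) (Phi y) ->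
  Phi x <> Phi y \/ Phi x <> (0, 0) ->
  exists (I : set R) (g : R -> B), [/\ straight_line I g, g @` I `<=` K,
    exists2 s, I s & g s = x & exists2 t, I t & g t = y].
Proof.
move=> Kx Ky xy ne; exists I01, (psi \o seg (Phi x) (Phi y)); split.
- by apply: same_side_line => //; exact: Q0.
- by move=> _ [t It <-]; have [] := psiP _ (Q_seg _ _ t (Q0 x Kx) (Q0 y Ky) It).
- by exists 0; [exact: I0|rewrite /= seg0 psiK].
- by exists 1; [exact: I1|rewrite /= seg1 psiK].
Qed.

Let convex_crossing x y : K x -> K y -> F x < 0 -> 0 < F y ->
  exists (I : set R) (g : R -> B), [/\ straight_line I g, g @` I `<=` K,
    exists2 s, I s & g s = x & exists2 t, I t & g t = y].
Proof.
move=> Kx Ky x0 y0; have [p [p0 p1 Qp reg]] := crossing_line x y Kx Ky x0 y0.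
exists I01, (psi \o p); split; first by left.
- by move=> _ [t It <-]; have [] := psiP _ (Qp t It).
- by exists 0; [exact: I0|rewrite /= p0 psiK].
- by exists 1; [exact: I1|rewrite /= p1 psiK].
Qed.

Lemma focus_box_convex : convex_subset K.
Proof.
move=> x y Kx Ky.
(* To join [O] to itself the constant path is not a straight line; a segment from [O] to another
   point of the box contains [O] and serves instead. *)
have [xO|nO] := pselect (x = y /\ Phi x = (0, 0)).
  have [r r0 rP] := box_near_O.
  have [|z Kz Fz] := rP (- (r / 2)); first by rewrite normrN gtr0_norm; lra.
  case: xO => <- xO.
  have [||I [g [gl gK [s Is sx] _]]] := convex_same_side x z Kx Kz.
  - by left; rewrite xO /= Fz; split; lra.
  - by left; rewrite xO /Phi Fz => -[]; lra.
  by exists I, g; split => //; exists s.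
have ne : Phi x <> Phi y \/ Phi x <> (0, 0).
  have [E|] := pselect (Phi x = (0, 0)); last by right.
  left => E'; apply: nO; split => //.
  by apply: PhiK_inj => //; exact: mem_set.
have [x0|x0] := leP (F x) 0; have [y0|y0] := leP (F y) 0.
- by apply: convex_same_side => //; left.
- have [x0'|x0'] := ltP (F x) 0; first exact: convex_crossing.
  by apply: convex_same_side => //; right; split => //; exact: ltW.
- have [y0'|y0'] := ltP (F y) 0; last first.
    by apply: convex_same_side => //; right; split => //; exact: ltW.
  have [I [g [? ? ? ?]]] := convex_crossing y x Ky Kx y0' x0.
  by exists I, g.
- by apply: convex_same_side => //; right; split; exact: ltW.
Qed.

End FocusBox.

Theorem theorem7p1 (R : realType) (B : focus_affine_surface R) (O : B) (k : R)
    (c : chart R B) (Gl Gr : B -> R) (delta delta' : R) :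
  focus_coordinates (@atlas R B) (@affine R B) O k c Gl Gr ->
  Gl O = 0 -> Gr O = 0 ->
  0 < delta -> 0 < delta' ->
  compact (focus_box c Gl Gr delta delta') ->
  convex_subset (focus_box c Gl Gr delta delta').
Proof.
move=> foc GlO _ d0 d'0 cK.
exact: focus_box_convex foc GlO d0 d'0 cK.
Qed.
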